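(* Let $d$ be a positive integer, $0<p<1$, and let $\mu$ be a Borel probability measure on $\mathbb{S}^{d-1}$. Then $$\int_{\mathbb{S}^{d-1}}\int_{\mathbb{S}^{d-1}}\int_{\mathbb{S}^{d-1}}\left|\langle x,y\rangle\langle x,z\rangle\langle y,z\rangle\right|^p\,d\mu(x)\,d\mu(y)\,d\mu(z)\ge\frac{1}{d^2},$$ with equality if and only if $\mu$ is, up to central symmetry, the uniform distribution over an orthonormal basis; that is, if and only if there is an orthonormal basis $e_1,\dots,e_d$ of $\mathbb{R}^d$ such that $\mu$ is supported on $\{\pm e_1,\dots,\pm e_d\}$ and $\mu(\{e_j,-e_j\})=\frac1d$ for each $j=1,\dots,d$.
   Context: $\mathbb{S}^{d-1}$ is the unit sphere of $\mathbb{R}^d$ and $\langle\cdot,\cdot\rangle$ the Euclidean inner product. *)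

(* Defs.v *)
From HB Require Import structures.
From mathcomp Require Import all_boot all_order all_algebra.
From mathcomp Require Import all_classical all_reals all_analysis.
Set Implicit Arguments. Unset Strict Implicit. Unset Printing Implicit Defensive.
Import Order.TTheory GRing.Theory Num.Theory.
Import numFieldNormedType.Exports.
Local Open Scope classical_set_scope.
Local Open Scope ring_scope.

Definition dotv (R : realType) (d : nat) (x y : 'rV[R]_d) : R :=
  \sum_(i < d) x ord0 i * y ord0 i.

Definition sphere (R : realType) (d : nat) : set 'rV[R]_d :=
  [set x | dotv x x = 1].

(* R^d equipped with its Borel sigma-algebra (generated by the open sets
   of the usual (product = Euclidean) topology on 'rV[R]_d). *)
Definition borelRV (R : realType) (d : nat) :=
  g_sigma_algebraType (@open 'rV[R]_d).

Definition borelRV_display (R : realType) (d : nat) : measure_display :=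
  sigma_display (@open 'rV[R]_d).

Definition orthonormal_basis (R : realType) (d : nat) (e : 'I_d -> 'rV[R]_d) :=
  forall i j : 'I_d, dotv (e i) (e j) = (i == j)%:R.

(* Main.v *)
(** On the sphere [u = <x,y><x,z><y,z>] satisfies [|u| <= 1], so
    [|u|^p >= u] for [0 < p < 1].  With [A] the second moment matrix of [mu],
    integrating [u] over [x] and [y] gives [|A z|^2], which is at least
    [(2/d) <z, A z> - 1/d^2]; integrating over [z] gives
    [(2/d) sum A_ij^2 - 1/d^2 >= 1/d^2] because [tr A = 1].

    Equality forces [A = I/d] and [|u|^p = u], i.e. [u] is 0 or 1, almost
    everywhere.  Since the [x]-integral of [u] is then [<y,z>^2 / d], almost
    all [y], [z] are orthogonal or equal up to sign; hence the integral
    [1/d] of [<y,z>^2] over [y] is the mass of [{z, -z}], for almost every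
    [z].  As long as fewer than [d] orthonormal atoms [{e_i, -e_i}] have been
    chosen, they miss some mass, which contains a further orthogonal one. *)
Require Import Defs.
From HB Require Import structures.
From mathcomp Require Import all_boot all_order all_algebra.
From mathcomp Require Import all_classical all_reals all_analysis.
From mathcomp Require Import measurable_realfun ring lra.
Import Order.TTheory GRing.Theory Num.Theory.
Import numFieldNormedType.Exports.
Local Open Scope classical_set_scope.
Local Open Scope ring_scope.

(** * Integration of bounded measurable functions and almost-everywhere reasoning *)

Section BoundedMeasurable.
Context {disp : measure_display} {T : measurableType disp} {R : realType}.
Context (mu : probability T R) (S : set T).
Hypothesis mS : measurable S.

(** The bound is asked on [S] only: coordinates are measurable on the whole space but bounded just
    on the sphere. *)
Definition bdd_meas (f : T -> R) :=
  measurable_fun setT f /\ exists M : R, forall x, S x -> `|f x| <= M.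

Lemma bdd_meas_cst (c : R) : bdd_meas (fun=> c).
Proof. by split; [exact: measurable_cst|exists `|c|]. Qed.

Lemma bdd_measD {f g : T -> R} :
  bdd_meas f -> bdd_meas g -> bdd_meas (fun x => f x + g x).
Proof.
move=> [mf [M fM]] [mg [N gN]]; split; first exact: measurable_funD.
by exists (M + N) => x Sx; rewrite (le_trans (ler_normD _ _))// lerD ?fM ?gN.
Qed.

Lemma bdd_measM {f g : T -> R} :
  bdd_meas f -> bdd_meas g -> bdd_meas (fun x => f x * g x).
Proof.
move=> [mf [M fM]] [mg [N gN]]; split; first exact: measurable_funM.
by exists (M * N) => x Sx; rewrite normrM ler_pM ?fM ?gN.
Qed.

Lemma bdd_measZ (c : R) {f : T -> R} :
  bdd_meas f -> bdd_meas (fun x => c * f x).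
Proof. exact/bdd_measM/bdd_meas_cst. Qed.

Lemma bdd_measB {f g : T -> R} :
  bdd_meas f -> bdd_meas g -> bdd_meas (fun x => f x - g x).
Proof.
move=> bf bg; have := bdd_measD bf (bdd_measZ (-1) bg).
by under eq_fun do rewrite mulN1r.
Qed.

Lemma bdd_meas_sum {I : Type} (s : seq I) {f : I -> T -> R} :
  (forall i, bdd_meas (f i)) -> bdd_meas (fun x => \sum_(i <- s) f i x).
Proof.
move=> bf; elim: s => [|i s IH].
  by under eq_fun do rewrite big_nil; exact: bdd_meas_cst.
by under eq_fun do rewrite big_cons; exact: bdd_measD.
Qed.

Lemma bdd_meas_integrable {f : T -> R} :
  bdd_meas f -> mu.-integrable S (EFin \o f).
Proof.
move=> [mf [M fM]]; apply: measurable_bounded_integrable => //.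
- by rewrite (le_lt_trans (probability_le1 mu mS))// ltry.
- exact: measurable_funTS.
- exists M; split; first by rewrite num_real.
  by move=> N MN x Sx /=; rewrite (le_trans (fM _ Sx))// ltW.
Qed.

Lemma bdd_meas_EFin {f : T -> R} : bdd_meas f ->
  (\int[mu]_(x in S) (f x)%:E)%E = (\int[mu]_(x in S) f x)%:E.
Proof.
by move=> bf; rewrite fineK//; apply: integrable_fin_num => //;
  exact: bdd_meas_integrable.
Qed.

Lemma Rintegral_bdd_sum {I : Type} (s : seq I) {f : I -> T -> R} :
  (forall i, bdd_meas (f i)) ->
  \int[mu]_(x in S) (\sum_(i <- s) f i x) =
    \sum_(i <- s) \int[mu]_(x in S) f i x.
Proof.
move=> bf; elim: s => [|i s IH].
  under eq_Rintegral do rewrite big_nil.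
  by rewrite big_nil Rintegral_cst// mul0r.
under eq_Rintegral do rewrite big_cons.
rewrite RintegralD//; [|exact: bdd_meas_integrable|].
  by rewrite big_cons IH.
exact/bdd_meas_integrable/bdd_meas_sum.
Qed.

(** Serves the equality case, with [f] the gap between the two sides of a pointwise inequality whose
    integrals agree. *)
Lemma Rintegral_ge0_eq0 {f : T -> R} : bdd_meas f ->
  (forall x, S x -> 0 <= f x) -> \int[mu]_(x in S) f x = 0 ->
  {ae mu, forall x, S x -> f x = 0}.
Proof.
move=> bf f0 If; have [mf _] := bf.
have mEf : measurable_fun S (EFin \o f).
  by apply/measurable_EFinP; exact: measurable_funTS.
have /ae_eq_integral_abs : (\int[mu]_(x in S) `|(EFin \o f) x| = 0)%E.
  transitivity (\int[mu]_(x in S) (f x)%:E)%E.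
    by apply: eq_integral => x /set_mem Sx /=; rewrite ger0_norm// f0.
  by rewrite bdd_meas_EFin// If.
move=> /(_ mS mEf); apply: filterS => x /= h Sx.
by have [] := h Sx.
Qed.

Lemma ae_eq_Rintegral {f g : T -> R} :
  measurable_fun setT f -> measurable_fun setT g ->
  {ae mu, forall x, S x -> f x = g x} ->
  \int[mu]_(x in S) f x = \int[mu]_(x in S) g x.
Proof.
move=> mf mg fg; congr fine; apply: ae_eq_integral => //.
- by apply/measurable_EFinP; exact: measurable_funTS.
- by apply/measurable_EFinP; exact: measurable_funTS.
- by apply: filterS fg => x /= h Sx; rewrite h.
Qed.

(** Otherwise [B] would lie inside the negligible set where [P] fails. This turns almost-everywhere
    facts into actual points. *)
Lemma ae_exists {P : T -> Prop} (B : set T) : measurable B -> mu B != 0%E ->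
  {ae mu, forall x, P x} -> exists2 x, B x & P x.
Proof.
move=> mB B0 aeP; apply: contrapT => nex; move/eqP: B0; apply.
apply/negligibleP => //; apply: negligibleS aeP => x Bx /= Px.
by apply: nex; exists x.
Qed.

Lemma ae_mono {P Q : T -> Prop} : (forall x, P x -> Q x) ->
  {ae mu, forall x, P x} -> {ae mu, forall x, Q x}.
Proof. by move=> PQ; exact: filterS. Qed.

Lemma ae_in {P : T -> Prop} : mu (~` S) = 0%E ->
  {ae mu, forall x, S x -> P x} -> {ae mu, forall x, S x /\ P x}.
Proof.
move=> S0 aeP; have aeS : {ae mu, forall x, S x}.
  by apply/negligibleP => //; exact: measurableC.
by apply: filterS2 aeS aeP => x Sx /(_ Sx).
Qed.

End BoundedMeasurable.

(** Tonelli gives measurability of the integral over the whole space; as the complement of [S] is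
    null, restricting to [S] does not change it. *)
Lemma measurable_integral_param {d1 d2 : measure_display}
    {T1 : measurableType d1} {T2 : measurableType d2} {R : realType}
    (mu : probability T2 R) (S : set T2) (f : T1 -> T2 -> R) :
  measurable S -> mu (~` S) = 0%E ->
  measurable_fun setT (fun u : T1 * T2 => f u.1 u.2) ->
  (forall a x, 0 <= f a x) ->
  measurable_fun setT (fun a => \int[mu]_(x in S) f a x).
Proof.
move=> mS S0 mf f0.
have mF := @measurable_fun_fubini_tonelli_F _ _ T1 T2 R mu
  (fun u => (f u.1 u.2)%:E) (iffRL (measurable_EFinP _ _) mf)
  (fun u => f0 u.1 u.2).
apply: (measurableT_comp (@fine_measurable R setT measurableT)).
apply: eq_measurable_fun mF => a _; rewrite /fubini_F /=.
rewrite (@ge0_negligible_integral _ _ _ mu setT (~` S))//.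
- by rewrite setTD setCK.
- exact: measurableC.
- by apply/measurable_EFinP; exact: measurableT_comp mf (pair1_measurable _).
- by move=> x _; rewrite lee_fin.
Qed.

(** * The Euclidean inner product and Borel measurability *)

Section DotProduct.
Context {R : realType} {d : nat}.
Implicit Types x y z u v : 'rV[R]_d.

Lemma dotvC x y : dotv x y = dotv y x.
Proof. by apply: eq_bigr => i _; rewrite mulrC. Qed.

Lemma dotvDl x y z : dotv (x + y) z = dotv x z + dotv y z.
Proof. by rewrite -big_split; apply: eq_bigr => i _; rewrite mxE mulrDl. Qed.

Lemma dotvZl (c : R) x y : dotv (c *: x) y = c * dotv x y.
Proof. by rewrite mulr_sumr; apply: eq_bigr => i _; rewrite mxE mulrA. Qed.

Lemma dotvNl x y : dotv (- x) y = - dotv x y.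
Proof. by rewrite -scaleN1r dotvZl mulN1r. Qed.

Lemma dotvDr x y z : dotv x (y + z) = dotv x y + dotv x z.
Proof. by rewrite dotvC dotvDl !(dotvC x). Qed.

Lemma dotvZr (c : R) x y : dotv x (c *: y) = c * dotv x y.
Proof. by rewrite dotvC dotvZl dotvC. Qed.

Lemma dotvNr x y : dotv x (- y) = - dotv x y.
Proof. by rewrite dotvC dotvNl dotvC. Qed.

Lemma dotvv_ge0 x : 0 <= dotv x x.
Proof. by apply: sumr_ge0 => i _; rewrite -expr2 sqr_ge0. Qed.

Lemma dotvv_eq0 x : dotv x x = 0 -> x = 0.
Proof.
move=> /eqP; rewrite psumr_eq0 => [/allP x0|i _]; last by rewrite -expr2 sqr_ge0.
apply/rowP => i; rewrite mxE; have /= := x0 i (mem_index_enum i).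
by rewrite mulf_eq0 orbb => /eqP.
Qed.

Lemma sphereN x : sphere x -> sphere (- x).
Proof. by rewrite /sphere /= dotvNl dotvNr opprK. Qed.

Lemma dotv_norm_le1 x y : sphere x -> sphere y -> `|dotv x y| <= 1.
Proof.
rewrite /sphere /= => Sx Sy.
have := dotvv_ge0 (x - y); have := dotvv_ge0 (x + y).
rewrite !(dotvDl, dotvDr, dotvNl, dotvNr) Sx Sy (dotvC y x) ler_norml => h1 h2.
by apply/andP; split; lra.
Qed.

(** Equality case of Cauchy-Schwarz: for unit vectors [|x - y|^2 = 2 - 2<x,y>] and
    [|x + y|^2 = 2 + 2<x,y>], so one of the two vanishes. *)
Lemma dotv_sqr_eq1 x y : sphere x -> sphere y ->
  (dotv x y ^+ 2 == 1) = (x == y) || (x == - y).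
Proof.
rewrite /sphere /= => Sx Sy; apply/idP/orP; last first.
  by move=> [/eqP->|/eqP->]; rewrite ?dotvNl Sy ?sqrrN expr1n.
rewrite sqrf_eq1 => /orP[] /eqP xy; [left|right].
  rewrite -subr_eq0; apply/eqP/dotvv_eq0.
  by rewrite !(dotvDl, dotvDr, dotvNl, dotvNr) Sx Sy (dotvC y x) xy; lra.
rewrite -[- y]add0r -subr_eq opprK; apply/eqP/dotvv_eq0.
by rewrite !(dotvDl, dotvDr) Sx Sy (dotvC y x) xy; lra.
Qed.

Lemma sphere_coord_le1 x (i : 'I_d) : sphere x -> `|x ord0 i| <= 1.
Proof.
rewrite /sphere /= => Sx; rewrite -(ler_pXn2r (n := 2)) ?nnegrE// expr1n.
rewrite real_normK ?num_real// -Sx /dotv (bigD1 i)//= -expr2 lerDl.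
by apply: sumr_ge0 => j _; rewrite -expr2 sqr_ge0.
Qed.

Lemma measurable_coord (i : 'I_d) :
  measurable_fun setT (fun x : borelRV R d => (x : 'rV[R]_d) ord0 i).
Proof.
apply: (measurability _ (RGenOInfty.measurableE R)) => _ [_ [r ->] <-].
rewrite setTI; apply: sub_sigma_algebra.
apply: open_comp; last exact: rray_open.
by move=> x _; exact: coord_continuous.
Qed.

Lemma measurable_dotv {disp} {T : measurableType disp} {f g : T -> borelRV R d} :
  measurable_fun setT f -> measurable_fun setT g ->
  measurable_fun setT (fun t => dotv (f t : 'rV[R]_d) (g t)).
Proof.
move=> mf mg; apply: measurable_sum => i.
apply: measurable_funM.
- exact: (measurableT_comp (measurable_coord i) mf).
- exact: (measurableT_comp (measurable_coord i) mg).
Qed.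

Lemma measurable_sphere : measurable (@sphere R d : set (borelRV R d)).
Proof.
have mid : measurable_fun setT (@id (borelRV R d)) by exact: measurable_id.
have := measurable_dotv mid mid measurableT [set 1] (measurable_set1 1).
by rewrite setTI.
Qed.

Lemma measurable_rV1 x : measurable ([set x] : set (borelRV R d)).
Proof.
have -> : [set x] = \bigcap_(i in [set: 'I_d])
    [set y : 'rV[R]_d | y ord0 i = x ord0 i].
  apply/seteqP; split=> [y -> //|y xy /=].
  by apply/rowP => i; exact: xy.
apply: fin_bigcap_measurable => // i _.
by have := measurable_coord i measurableT [set x ord0 i] (measurable_set1 _);
  rewrite setTI.
Qed.

Lemma measurable_pm x : measurable ([set x; - x] : set (borelRV R d)).
Proof. by apply: measurableU; exact: measurable_rV1. Qed.

End DotProduct.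

(** * Comparison of [a] with its power [p] on the unit interval *)

Lemma le_powR1 {R : realType} (p a : R) : 0 < p < 1 -> 0 <= a <= 1 -> a <= a `^ p.
Proof.
move=> /andP[p0 p1] /andP[a0 a1]; have [->|an0] := eqVneq a 0.
  by rewrite powR_ge0.
rewrite -[leLHS]powRr1// ger_powR//; last exact: ltW.
by rewrite lt_neqAle eq_sym an0 a0 a1.
Qed.

(** For [a > 0], taking logarithms gives [p * ln a = ln a], and [p < 1] forces [ln a = 0]. *)
Lemma powR_fixpoint {R : realType} (p a : R) :
  0 < p < 1 -> 0 <= a -> a `^ p = a -> a = 0 \/ a = 1.
Proof.
move=> /andP[p0 p1] a0 apa; have [->|an0] := eqVneq a 0; [by left|right].
have a_gt0 : 0 < a by rewrite lt_neqAle eq_sym an0.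
have /eqP := congr1 (@ln R) apa.
rewrite ln_powR -subr_eq0 -{2}[ln a]mul1r -mulrBl mulf_eq0 subr_eq0 (lt_eqF p1) /=.
by rewrite ln_eq0// => /eqP.
Qed.

(** * The integrand: bounds, equality case, sign invariance *)

Section TripleProduct.
Context {R : realType} {d : nat}.

Definition triple (x y z : 'rV[R]_d) : R := dotv x y * dotv x z * dotv y z.

Lemma triple_norm_le1 {x y z : 'rV[R]_d} :
  sphere x -> sphere y -> sphere z -> `|triple x y z| <= 1.
Proof.
move=> Sx Sy Sz; rewrite !normrM.
by rewrite mulr_ile1 ?mulr_ile1 ?mulr_ge0 ?dotv_norm_le1.
Qed.

Lemma triple_le_powR (p : R) {x y z : 'rV[R]_d} : 0 < p < 1 ->
  sphere x -> sphere y -> sphere z -> triple x y z <= `|triple x y z| `^ p.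
Proof.
move=> p01 Sx Sy Sz; rewrite (le_trans (ler_norm _))//.
by rewrite le_powR1// normr_ge0 triple_norm_le1.
Qed.

Lemma triple_powR_le1 (p : R) {x y z : 'rV[R]_d} : 0 < p < 1 ->
  sphere x -> sphere y -> sphere z -> `|triple x y z| `^ p <= 1.
Proof.
move=> /andP[p0 _] Sx Sy Sz; have <- : 1 `^ p = 1 :> R by rewrite powR1.
by apply: ge0_ler_powR; rewrite ?nnegrE ?triple_norm_le1// ltW.
Qed.

(** The product is then a nonnegative fixed point of the power map, hence 0 or 1. When it is 1, each
    of its factors, of modulus at most 1, has modulus 1. Only the factor free of [x] is recorded,
    since [x] is integrated out later. *)
Lemma triple_eq_powR (p : R) {x y z : 'rV[R]_d} : 0 < p < 1 ->
  sphere x -> sphere y -> sphere z ->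
  `|triple x y z| `^ p = triple x y z ->
  triple x y z = 0 \/ dotv y z ^+ 2 = 1.
Proof.
move=> p01 Sx Sy Sz pE; have t0 : 0 <= triple x y z by rewrite -pE powR_ge0.
have := pE; rewrite (ger0_norm t0) => /(powR_fixpoint _ _ p01 t0)[]; first by left.
move=> t1; right; apply/eqP; rewrite eq_le; apply/andP; split.
  by rewrite -real_normK ?num_real// expr_le1// dotv_norm_le1.
rewrite -real_normK ?num_real// exprn_ege1// -[leLHS](ger0_norm ler01) -t1.
by rewrite [in leLHS]/triple !normrM ler_piMl// mulr_ile1 ?dotv_norm_le1.
Qed.

Lemma tripleNl (x y z : 'rV[R]_d) : triple (- x) y z = triple x y z.
Proof. by rewrite /triple !dotvNl mulrNN. Qed.

Lemma tripleNm (x y z : 'rV[R]_d) : triple x (- y) z = triple x y z.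
Proof. by rewrite /triple dotvNr dotvNl !(mulNr, mulrN) opprK. Qed.

Lemma tripleNr (x y z : 'rV[R]_d) : triple x y (- z) = triple x y z.
Proof. by rewrite /triple !dotvNr !(mulNr, mulrN) opprK. Qed.

Lemma measurable_triple_powR (p : R) {disp} {T : measurableType disp}
    {f g h : T -> borelRV R d} :
  measurable_fun setT f -> measurable_fun setT g -> measurable_fun setT h ->
  measurable_fun setT (fun t => `|triple (f t) (g t) (h t)| `^ p).
Proof.
move=> mf mg mh; apply: (measurableT_comp (measurable_powR p)).
apply: measurableT_comp => //.
by apply: measurable_funM; [apply: measurable_funM|]; apply: measurable_dotv.
Qed.

End TripleProduct.

(** * The second moment matrix of the measure *)

Section Moments.
Context {R : realType} {d : nat} (mu : probability (borelRV R d) R).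
Hypothesis d_gt0 : (0 < d)%N.
Hypothesis muS : mu (~` @sphere R d) = 0%E.

Let S : set (borelRV R d) := @sphere R d.
Let mS : measurable S := measurable_sphere.
Let D : R := d%:R.
Let D_gt0 : 0 < D. Proof. by rewrite ltr0n. Qed.

Lemma mu_sphere1 : mu S = 1%E.
Proof.
have := probability_setC mu (measurableC mS).
by rewrite setCK muS sube0.
Qed.

Lemma Rintegral_sphere_cst (c : R) : \int[mu]_(x in S) c = c.
Proof.
rewrite Rintegral_cst// -[RHS]mulr1; congr (_ * _).
by have := congr1 fine mu_sphere1; apply.
Qed.

Lemma bdd_coord (i : 'I_d) : bdd_meas S (fun x => (x : 'rV[R]_d) ord0 i).
Proof.
by split; [exact: measurable_coord|exists 1 => x; exact: sphere_coord_le1].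
Qed.

Lemma bdd_dot (v : 'rV[R]_d) : bdd_meas S (fun x => dotv (x : 'rV[R]_d) v).
Proof.
apply: bdd_meas_sum => i.
exact: bdd_measM (bdd_coord i) (bdd_meas_cst _ _).
Qed.

Definition moment (i j : 'I_d) : R :=
  \int[mu]_(x in S) ((x : 'rV[R]_d) ord0 i * (x : 'rV[R]_d) ord0 j).

Definition moment_op (v : 'rV[R]_d) : 'rV[R]_d :=
  \row_i \sum_j moment i j * v ord0 j.

(** The bilinear form of the second moment matrix: expand both inner products in coordinates and
    exchange the finite sums with the integral. *)
Lemma Rintegral_dot2 (u v : 'rV[R]_d) :
  \int[mu]_(x in S) (dotv (x : 'rV[R]_d) u * dotv (x : 'rV[R]_d) v) =
  dotv u (moment_op v).
Proof.
have bc2 i j : bdd_meas S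
    (fun x => (x : 'rV[R]_d) ord0 i * (x : 'rV[R]_d) ord0 j).
  by apply: bdd_measM; exact: bdd_coord.
transitivity (\int[mu]_(x in S) (\sum_i \sum_j (u ord0 i * v ord0 j) *
   ((x : 'rV[R]_d) ord0 i * (x : 'rV[R]_d) ord0 j))).
  apply: eq_Rintegral => x _; rewrite mulr_suml; apply: eq_bigr => i _.
  by rewrite mulr_sumr; apply: eq_bigr => j _; ring.
rewrite Rintegral_bdd_sum//; last first.
  by move=> i; apply: bdd_meas_sum => j; exact: bdd_measZ.
apply: eq_bigr => i _; rewrite Rintegral_bdd_sum//; last first.
  by move=> j; exact: bdd_measZ.
rewrite mxE mulr_sumr; apply: eq_bigr => j _.
by rewrite RintegralZl//; [rewrite -/(moment i j); ring|exact: bdd_meas_integrable].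
Qed.

Lemma Rintegral_triple (y z : 'rV[R]_d) :
  \int[mu]_(x in S) triple x y z = dotv y z * dotv y (moment_op z).
Proof.
rewrite -Rintegral_dot2 -RintegralZl//; last first.
  by apply: bdd_meas_integrable => //; apply: bdd_measM; exact: bdd_dot.
by apply: eq_Rintegral => x _; rewrite /triple mulrC.
Qed.

Lemma Rintegral_triple2 (z : 'rV[R]_d) :
  \int[mu]_(y in S) (dotv (y : 'rV[R]_d) z * dotv (y : 'rV[R]_d) (moment_op z)) =
  dotv (moment_op z) (moment_op z).
Proof.
rewrite -Rintegral_dot2.
by apply: eq_Rintegral => y _; rewrite mulrC.
Qed.

(** The summed integrand is [|x|^2], constant 1 on the sphere. *)
Lemma moment_trace : \sum_i moment i i = 1.
Proof.
rewrite -Rintegral_bdd_sum//; last first.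
  by move=> i; apply: bdd_measM; exact: bdd_coord.
by rewrite -[RHS]Rintegral_sphere_cst; apply: eq_Rintegral => x /set_mem.
Qed.

(** Squared Frobenius norm of the second moment matrix. *)
Definition moment_sqnorm : R := \sum_i \sum_j moment i j ^+ 2.

Lemma bdd_moment_op (i : 'I_d) :
  bdd_meas S (fun x => moment_op (x : 'rV[R]_d) ord0 i).
Proof.
under eq_fun do rewrite mxE.
by apply: bdd_meas_sum => j; apply: bdd_measZ; exact: bdd_coord.
Qed.

Lemma bdd_dot_moment_op :
  bdd_meas S (fun x => dotv (x : 'rV[R]_d) (moment_op x)).
Proof.
apply: bdd_meas_sum => i; apply: bdd_measM; first exact: bdd_coord.
exact: bdd_moment_op.
Qed.

Lemma bdd_moment_op2 :
  bdd_meas S (fun x => dotv (moment_op x) (moment_op x)).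
Proof. by apply: bdd_meas_sum => i; apply: bdd_measM; exact: bdd_moment_op. Qed.

Lemma Rintegral_dot_moment_op :
  \int[mu]_(z in S) dotv (z : 'rV[R]_d) (moment_op z) = moment_sqnorm.
Proof.
rewrite Rintegral_bdd_sum//; last first.
  move=> i; apply: bdd_measM; first exact: bdd_coord.
  exact: bdd_moment_op.
apply: eq_bigr => i _.
transitivity (\int[mu]_(x in S) (\sum_j moment i j *
   ((x : 'rV[R]_d) ord0 i * (x : 'rV[R]_d) ord0 j))).
  apply: eq_Rintegral => x _; rewrite mxE mulr_sumr.
  by apply: eq_bigr => j _; ring.
have bc2 j : bdd_meas S
    (fun x => (x : 'rV[R]_d) ord0 i * (x : 'rV[R]_d) ord0 j).
  by apply: bdd_measM; exact: bdd_coord.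
rewrite Rintegral_bdd_sum//; last by move=> j; exact: bdd_measZ.
apply: eq_bigr => j _.
by rewrite RintegralZl//; exact: bdd_meas_integrable.
Qed.

(** The squared Frobenius distance from [A] to [I/d], expanded with trace 1. Its nonnegativity gives
    the lower bound on [moment_sqnorm], and its vanishing identifies [A] in the equality case. *)
Lemma moment_dist_scalar :
  \sum_i \sum_j (moment i j - (i == j)%:R / D) ^+ 2 = moment_sqnorm - D^-1.
Proof.
(* In row [i] only the diagonal entry differs from [moment i j ^+ 2]; it contributes the cross term
   and the constant. *)
transitivity (\sum_i (\sum_j moment i j ^+ 2 - (2 / D * moment i i - D ^- 2))).
  apply: eq_bigr => i _; rewrite (bigD1 i)//= [in RHS](bigD1 i)//= eqxx.
  rewrite [X in _ + X](eq_bigr (fun j => moment i j ^+ 2)); last first.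
    by move=> j /negPf; rewrite eq_sym => ->; rewrite mul0r subr0.
  rewrite mulr1n mul1r -exprVn; set x := D^-1; ring.
rewrite !sumrB -mulr_sumr moment_trace sumr_const card_ord -[_ *+ d]mulr_natl -/D.
by rewrite -/moment_sqnorm; field; exact: lt0r_neq0.
Qed.

Lemma moment_sqnorm_ge : D^-1 <= moment_sqnorm.
Proof.
rewrite -subr_ge0 -moment_dist_scalar.
by do 2 (apply: sumr_ge0 => ? _); rewrite sqr_ge0.
Qed.

Lemma moment_op_scalar (v : 'rV[R]_d) :
  moment_sqnorm = D^-1 -> moment_op v = D^-1 *: v.
Proof.
move=> qE; have /eqP := moment_dist_scalar; rewrite qE subrr.
rewrite psumr_eq0 => [/allP h1|i _]; last first.
  by apply: sumr_ge0 => j _; rewrite sqr_ge0.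
have mE i j : moment i j = (i == j)%:R / D.
  have /= := h1 i (mem_index_enum i).
  rewrite psumr_eq0 => [/allP h2|k _]; last by rewrite sqr_ge0.
  by have /= := h2 j (mem_index_enum j); rewrite sqrf_eq0 subr_eq0 => /eqP.
apply/rowP => i; rewrite !mxE (bigD1 i)//= big1 ?addr0 ?mE ?eqxx ?mul1r//.
by move=> j /negPf ji; rewrite mE eq_sym ji !mul0r.
Qed.

Lemma Rintegral_moment_op2_ge :
  2 / D * moment_sqnorm - D ^- 2 <=
  \int[mu]_(z in S) dotv (moment_op z) (moment_op z).
Proof.
rewrite -Rintegral_dot_moment_op -RintegralZl//; last first.
  exact/bdd_meas_integrable/bdd_dot_moment_op.
rewrite -[D ^- 2]Rintegral_sphere_cst -RintegralB//; last 2 first.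
- exact/bdd_meas_integrable/bdd_measZ/bdd_dot_moment_op.
- exact/bdd_meas_integrable/bdd_meas_cst.
apply: le_Rintegral => //.
- apply/bdd_meas_integrable/bdd_measB; last exact: bdd_meas_cst.
    by [].
  exact/bdd_measZ/bdd_dot_moment_op.
- exact/bdd_meas_integrable/bdd_moment_op2.
(* On the sphere, [|A z - z/d|^2 >= 0] expands to [|A z|^2 >= (2/d) <z, A z> - 1/d^2]. *)
move=> z Sz; have := dotvv_ge0 (moment_op z - D^-1 *: z).
rewrite !(dotvDl, dotvDr, dotvNl, dotvNr, dotvZl, dotvZr) (dotvC (moment_op z) z).
rewrite (_ : dotv z z = 1)// -exprVn; set x := D^-1; lra.
Qed.

End Moments.

(** * The triple integral and its lower bound *)

Section Energy.
Context {R : realType} {d : nat} (p : R) (mu : probability (borelRV R d) R).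
Hypothesis p01 : 0 < p < 1.
Hypothesis d_gt0 : (0 < d)%N.
Hypothesis muS : mu (~` @sphere R d) = 0%E.

Let S : set (borelRV R d) := @sphere R d.
Let mS : measurable S := measurable_sphere.
Let D : R := d%:R.
Let D_gt0 : 0 < D. Proof. by rewrite ltr0n. Qed.
Let F (x y z : 'rV[R]_d) : R := `|triple x y z| `^ p.

(** Real-valued, so that linear arithmetic applies; [energyE] returns to the iterated extended-real
    integral. *)
Definition inner_energy (y z : 'rV[R]_d) : R := \int[mu]_(x in S) F x y z.

Definition outer_energy (z : 'rV[R]_d) : R :=
  \int[mu]_(y in S) inner_energy y z.

Lemma bdd_triple_powR (y z : 'rV[R]_d) : sphere y -> sphere z ->
  bdd_meas S (fun x => F x y z).
Proof.
move=> Sy Sz; split.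
  apply: measurable_triple_powR; [exact: measurable_id|exact: measurable_cst..].
by exists 1 => x Sx; rewrite ger0_norm ?powR_ge0// triple_powR_le1.
Qed.

Lemma bdd_triple (y z : 'rV[R]_d) : bdd_meas S (fun x => triple x y z).
Proof.
apply: bdd_measM; last exact: bdd_meas_cst.
by apply: bdd_measM; exact: bdd_dot.
Qed.

Lemma inner_energy_ge0 (y z : 'rV[R]_d) : 0 <= inner_energy y z.
Proof. by apply: Rintegral_ge0 => x _; exact: powR_ge0. Qed.

Lemma inner_energy_le1 (y z : 'rV[R]_d) :
  sphere y -> sphere z -> inner_energy y z <= 1.
Proof.
move=> Sy Sz; rewrite -[leRHS](Rintegral_sphere_cst _ muS).
apply: le_Rintegral => //.
- exact/bdd_meas_integrable/bdd_triple_powR.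
- exact/bdd_meas_integrable/bdd_meas_cst.
- by move=> x Sx; exact: triple_powR_le1.
Qed.

(** The pair is ordered as [(z, y)]: fixing its first component leaves the function of [y] that is
    integrated next. *)
Lemma measurable_inner_energy :
  measurable_fun setT
    (fun u : borelRV R d * borelRV R d => inner_energy u.2 u.1).
Proof.
rewrite /inner_energy.
apply: (measurable_integral_param mu S
  (fun (u : borelRV R d * borelRV R d) x => F x u.2 u.1)) => //; last by move=> *; exact: powR_ge0.
apply: measurable_triple_powR; first exact: measurable_snd.
- exact: measurableT_comp measurable_snd measurable_fst.
- exact: measurableT_comp measurable_fst measurable_fst.
Qed.

Lemma bdd_inner_energy (z : 'rV[R]_d) : sphere z ->
  bdd_meas S (fun y => inner_energy y z).
Proof.
move=> Sz; split.
  exact: measurableT_comp measurable_inner_energy (pair1_measurable _).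
by exists 1 => y Sy; rewrite ger0_norm ?inner_energy_ge0// inner_energy_le1.
Qed.

Lemma bdd_outer_energy : bdd_meas S outer_energy.
Proof.
split.
  rewrite /outer_energy; apply: (measurable_integral_param mu S
    (fun (z : borelRV R d) y => inner_energy y z)) => //; first exact: measurable_inner_energy.
  by move=> *; exact: inner_energy_ge0.
exists 1 => z Sz; rewrite ger0_norm; last first.
  by apply: Rintegral_ge0 => y _; exact: inner_energy_ge0.
rewrite -[leRHS](Rintegral_sphere_cst _ muS); apply: le_Rintegral => //.
- exact/bdd_meas_integrable/bdd_inner_energy.
- exact/bdd_meas_integrable/bdd_meas_cst.
- by move=> y Sy; exact: inner_energy_le1.
Qed.

Lemma energyE :
  (\int[mu]_(z in S) \int[mu]_(y in S) \int[mu]_(x in S)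
     (`| dotv x y * dotv x z * dotv y z | `^ p)%:E =
   (\int[mu]_(z in S) outer_energy z)%:E)%E.
Proof.
rewrite -bdd_meas_EFin//; last exact: bdd_outer_energy.
apply: eq_integral => z /set_mem Sz.
rewrite -bdd_meas_EFin//; last exact: bdd_inner_energy.
apply: eq_integral => y /set_mem Sy.
by rewrite -bdd_meas_EFin//; exact: bdd_triple_powR.
Qed.

Lemma inner_energy_ge (y z : 'rV[R]_d) : sphere y -> sphere z ->
  dotv y z * dotv y (moment_op mu z) <= inner_energy y z.
Proof.
move=> Sy Sz; rewrite -Rintegral_triple; apply: le_Rintegral => //.
- exact/bdd_meas_integrable/bdd_triple.
- exact/bdd_meas_integrable/bdd_triple_powR.
- by move=> x Sx; exact: triple_le_powR.
Qed.

Lemma bdd_dot2 (u v : 'rV[R]_d) :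
  bdd_meas S (fun y : borelRV R d => dotv (y : 'rV[R]_d) u * dotv (y : 'rV[R]_d) v).
Proof. by apply: bdd_measM; exact: bdd_dot. Qed.

Lemma outer_energy_ge (z : 'rV[R]_d) : sphere z ->
  dotv (moment_op mu z) (moment_op mu z) <= outer_energy z.
Proof.
move=> Sz; rewrite -Rintegral_triple2; apply: le_Rintegral => //.
- exact/bdd_meas_integrable/bdd_dot2.
- exact/bdd_meas_integrable/bdd_inner_energy.
- by move=> y Sy; exact: inner_energy_ge.
Qed.

Lemma moment_op_le_energy :
  \int[mu]_(z in S) dotv (moment_op mu z) (moment_op mu z) <=
  \int[mu]_(z in S) outer_energy z.
Proof.
apply: le_Rintegral => //; last exact: outer_energy_ge.
- exact/bdd_meas_integrable/bdd_moment_op2.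
- exact/bdd_meas_integrable/bdd_outer_energy.
Qed.

(** The excess of [moment_sqnorm] over its minimum is kept in the bound, so that equality of the
    energy forces this excess to be zero. *)
Lemma energy_ge_sqnorm :
  D ^- 2 + 2 / D * (moment_sqnorm mu - D^-1) <=
  \int[mu]_(z in S) outer_energy z.
Proof.
apply: le_trans moment_op_le_energy; apply: le_trans (Rintegral_moment_op2_ge _ muS).
by rewrite -/D -exprVn; set x := D^-1; lra.
Qed.

Lemma energy_ge : D ^- 2 <= \int[mu]_(z in S) outer_energy z.
Proof.
apply: le_trans energy_ge_sqnorm; rewrite lerDl mulr_ge0//.
  by rewrite divr_ge0// ltW.
by rewrite subr_ge0 moment_sqnorm_ge.
Qed.

(** * Consequences of equality *)

Section EqualityCase.
Hypothesis energy_eq : \int[mu]_(z in S) outer_energy z = D ^- 2.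

Lemma energy_eq_sqnorm : moment_sqnorm mu = D^-1.
Proof.
apply/eqP; rewrite eq_le moment_sqnorm_ge// andbT.
have := energy_ge_sqnorm; rewrite energy_eq gerDl pmulr_rle0 ?subr_le0//.
by rewrite divr_gt0.
Qed.

Lemma energy_eq_moment_op (v : 'rV[R]_d) : moment_op mu v = D^-1 *: v.
Proof. exact/moment_op_scalar/energy_eq_sqnorm. Qed.

(** The lower bound came from one pointwise inequality, integrated in turn over [x], [y] and [z].
    Equality is peeled off from the outermost integral inwards: each gap is nonnegative with zero
    integral, so it vanishes almost everywhere. Nested quantifiers match the iterated integrals. *)
Lemma energy_eq_ae : {ae mu, forall z, sphere z ->
  {ae mu, forall y, sphere y -> {ae mu, forall x, sphere x ->
    F x y z = triple x y z}}}.
Proof.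
have bo := bdd_outer_energy; have bm := @bdd_moment_op2 R d mu.
have : {ae mu, forall z, S z ->
    outer_energy z - dotv (moment_op mu z) (moment_op mu z) = 0}.
  apply: Rintegral_ge0_eq0 => //; first exact: bdd_measB.
    by move=> z Sz; rewrite subr_ge0 outer_energy_ge.
  rewrite RintegralB//; [|exact: bdd_meas_integrable..].
  apply/eqP; rewrite subr_eq0 eq_le moment_op_le_energy andbT energy_eq.
  (* With [moment_sqnorm] equal to [1/d], the bound [(2/d) (1/d) - 1/d^2] is exactly the energy
     [1/d^2]. *)
  apply: le_trans (Rintegral_moment_op2_ge _ muS).
  by rewrite energy_eq_sqnorm -/D -exprVn; set x := D^-1; lra.
apply: ae_mono => z hz Sz; have {}hz := hz Sz.
have bi := bdd_inner_energy z Sz; have bt := bdd_dot2 z (moment_op mu z).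
have : {ae mu, forall y, S y ->
    inner_energy y z - dotv (y : 'rV[R]_d) z * dotv (y : 'rV[R]_d) (moment_op mu z) = 0}.
  apply: Rintegral_ge0_eq0 => //; first exact: bdd_measB.
    by move=> y Sy; rewrite subr_ge0 inner_energy_ge.
  rewrite RintegralB//; [|exact: bdd_meas_integrable..].
  by rewrite Rintegral_triple2.
apply: ae_mono => y hy Sy; have {}hy := hy Sy.
have bF := bdd_triple_powR y z Sy Sz; have b3 := bdd_triple y z.
have : {ae mu, forall x, S x -> F x y z - triple x y z = 0}.
  apply: Rintegral_ge0_eq0 => //; first exact: bdd_measB.
    by move=> x Sx; rewrite subr_ge0 triple_le_powR.
  rewrite RintegralB//; [|exact: bdd_meas_integrable..].
  by rewrite Rintegral_triple.
by apply: ae_mono => x hx Sx; apply/eqP; rewrite -subr_eq0 hx.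
Qed.

(** If [<y,z>^2] is not 1, the triple product vanishes for almost every [x]; its integral over [x],
    which is [<y,z>^2 / d], is then 0. *)
Lemma energy_eq_dot : {ae mu, forall z, sphere z ->
  {ae mu, forall y, sphere y -> dotv y z = 0 \/ dotv y z ^+ 2 = 1}}.
Proof.
apply: (ae_mono mu _ energy_eq_ae) => z hz Sz.
apply: (ae_mono mu _ (hz Sz)) => y hy Sy.
have [yz1|yz1] := eqVneq (dotv y z ^+ 2) 1; [by right|left].
have : \int[mu]_(x in S) triple x y z = \int[mu]_(x in S) 0.
  apply: ae_eq_Rintegral => //; first by have [] := bdd_triple y z.
  apply: (ae_mono mu _ (hy Sy)) => x hx Sx.
  by case: (triple_eq_powR _ p01 Sx Sy Sz (hx Sx)) => // /eqP; rewrite (negPf yz1).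
rewrite Rintegral_sphere_cst// Rintegral_triple energy_eq_moment_op dotvZr.
move=> /eqP; rewrite mulrCA mulf_eq0 invr_eq0 (gt_eqF D_gt0) /= mulf_eq0 orbb.
by move=> /eqP.
Qed.

(** The integral of [<y,z>^2] over [y] is [<z, A z> = 1/d], while its integrand agrees almost
    everywhere with the indicator of [{z, -z}]. *)
Lemma energy_eq_atom (z : 'rV[R]_d) : sphere z ->
  {ae mu, forall y, sphere y -> dotv y z = 0 \/ dotv y z ^+ 2 = 1} ->
  mu [set z; - z] = (D^-1)%:E.
Proof.
move=> Sz hz; have mpm := measurable_pm z.
have pmS : [set z; - z] `<=` S by move=> y [->|->] //; exact: sphereN.
have <- : \int[mu]_(y in S) (dotv (y : 'rV[R]_d) z * dotv (y : 'rV[R]_d) z) = D^-1.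
  by rewrite Rintegral_dot2 energy_eq_moment_op dotvZr (_ : dotv z z = 1)// mulr1.
transitivity (\int[mu]_(y in S) (\1_([set z; - z] : set (borelRV R d)) y : R))%:E.
  rewrite /Rintegral integral_indic// setIidl//.
  by rewrite fineK// fin_num_measure.
congr EFin; apply: ae_eq_Rintegral => //.
  by have [] := bdd_dot2 z z.
apply: (ae_mono mu _ hz) => y hy Sy; rewrite -expr2 indicE.
have := dotv_sqr_eq1 y z Sy Sz; have [->|->] := hy Sy.
  rewrite expr0n /= eq_sym oner_eq0 => /esym /norP[/eqP yz /eqP yNz].
  by rewrite memNset// => -[].
rewrite eqxx => /esym/orP yz.
by rewrite mem_set//; case: yz => /eqP ->; [left|right].
Qed.

End EqualityCase.

End Energy.

Lemma bigsetU_ordP {T : Type} {n : nat} (A : 'I_n -> set T) (x : T) :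
  (\big[setU/set0]_(i < n) A i) x <-> exists i, A i x.
Proof.
rewrite -bigcup_seq; split=> [[i _ Aix]|[i Aix]]; first by exists i.
by exists i => //=; rewrite mem_index_enum.
Qed.

(** * Measures carried by an orthonormal basis up to sign *)

Section OrthonormalBasis.
Context {R : realType} {d : nat}.
Hypothesis d_gt0 : (0 < d)%N.
Let D : R := d%:R.
Let D_gt0 : 0 < D. Proof. by rewrite ltr0n. Qed.

Lemma orthonormal_sphere {e : 'I_d -> 'rV[R]_d} (i : 'I_d) :
  orthonormal_basis e -> sphere (e i).
Proof. by move=> oe; rewrite /sphere /= oe eqxx. Qed.

(** A point common to two distinct pairs would have squared inner product with [e j] equal to both 0
    and 1. *)
Lemma orthonormal_trivIset {e : 'I_d -> 'rV[R]_d} (I : set 'I_d) :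
  orthonormal_basis e -> trivIset I (fun i => [set e i; - e i]).
Proof.
move=> oe i j _ _ [x [xi xj]]; apply/eqP/negPn/negP => ij.
have Sx : sphere x by case: xi => ->; [|apply: sphereN]; exact: orthonormal_sphere.
have := dotv_sqr_eq1 x (e j) Sx (orthonormal_sphere j oe).
have -> : dotv x (e j) = 0.
  by case: xi => ->; rewrite ?dotvNl oe (negPf ij) ?oppr0.
rewrite expr0n /= eq_sym oner_eq0.
by case: xj => ->; rewrite eqxx ?orbT.
Qed.

(** * Energy of the uniform distribution on a basis *)

Section Converse.
Context (mu : probability (borelRV R d) R) (e : 'I_d -> 'rV[R]_d).
Hypothesis oe : orthonormal_basis e.
Hypothesis mu_supp : mu (~` [set x | exists j : 'I_d, x = e j \/ x = - e j]) = 0%E.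
Hypothesis mu_atom : forall j : 'I_d, mu [set e j; - e j] = (D^-1)%:E.

(** Only the disjoint pairs [{e i, - e i}] carry mass, and an even function is constant on each, so
    the way mass splits between [e i] and [- e i] is irrelevant. *)
Lemma integral_even (f : 'rV[R]_d -> R) :
  measurable_fun setT (f : borelRV R d -> R) ->
  (forall x, 0 <= f x) -> (forall x, f (- x) = f x) ->
  (\int[mu]_(x in @sphere R d) (f x)%:E = (\sum_i D^-1 * f (e i))%:E)%E.
Proof.
move=> mf f0 fN.
pose A i : set (borelRV R d) := [set e i; - e i].
have mA i : measurable (A i) by exact: measurable_pm.
pose U := \big[setU/set0]_(i < d) A i.
have mU : measurable U by apply: bigsetU_measurable => i _.
have suppE : [set x | exists j : 'I_d, x = e j \/ x = - e j] = U.
  apply/seteqP; split => x; first by move=> ?; apply/bigsetU_ordP.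
  by move=> /bigsetU_ordP.
have mEf B : measurable B -> measurable_fun B (EFin \o (f : borelRV R d -> R)).
  by move=> mB; apply/measurable_EFinP; exact: measurable_funTS.
rewrite (ge0_negligible_integral (N := ~` U)); last 5 first.
- exact: measurableC.
- exact: measurable_sphere.
- by apply: mEf; exact: measurable_sphere.
- by move=> x _; rewrite lee_fin.
- by rewrite -suppE.
have -> : (@sphere R d : set (borelRV R d)) `\` ~` U = U.
  rewrite setDE setCK setIidr// => x /bigsetU_ordP[i [->|->]].
    exact: orthonormal_sphere.
  exact/sphereN/orthonormal_sphere.
rewrite ge0_integral_bigsetU//; last 4 first.
- exact: index_enum_uniq.
- exact: orthonormal_trivIset.
- exact: mEf.
- by move=> x _; rewrite lee_fin.
rewrite -sumEFin; apply: eq_bigr => i _.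
transitivity (\int[mu]_(x in A i) (f (e i))%:E)%E.
  by apply: eq_integral => x /set_mem[->|->] //; rewrite fN.
rewrite integral_cst// [in RHS]mulrC EFinM.
by congr (_ * _)%E; exact: mu_atom.
Qed.

Lemma triple_orthonormal (p : R) (i j k : 'I_d) : 0 < p < 1 ->
  `|triple (e i) (e j) (e k)| `^ p = ((i == j) && (j == k))%:R.
Proof.
move=> /andP[p0 _]; rewrite /triple !oe.
have [->|ij] := eqVneq i j; last by rewrite !mul0r normr0 powR0// gt_eqF.
have [_|jk] := eqVneq j k; last by rewrite !mulr0 normr0 powR0// gt_eqF.
by rewrite !mulr1 normr1 powR1.
Qed.

(** Three uses of [integral_even] give a triple sum with weights [1/d^3]; orthonormality leaves the
    [d] diagonal terms, hence [d / d^3]. *)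
Lemma orthonormal_energy (p : R) : 0 < p < 1 ->
  (\int[mu]_(z in @sphere R d) \int[mu]_(y in @sphere R d)
       \int[mu]_(x in @sphere R d)
         (`| dotv x y * dotv x z * dotv y z | `^ p)%:E
    = (D ^- 2)%:E)%E.
Proof.
move=> p01; pose F (x y z : 'rV[R]_d) : R := `|triple x y z| `^ p.
have mid : measurable_fun setT (@id (borelRV R d)) by exact: measurable_id.
have F0 x y z : 0 <= F x y z by exact: powR_ge0.
have D0 : 0 <= D^-1 by rewrite invr_ge0 ltW.
have intx y z : (\int[mu]_(x in @sphere R d) (F x y z)%:E =
    (\sum_i D^-1 * F (e i) y z)%:E)%E.
  rewrite integral_even//.
    by apply: measurable_triple_powR => //; exact: measurable_cst.
  by move=> x; rewrite /F tripleNl.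
have inty z : (\int[mu]_(y in @sphere R d) (\sum_i D^-1 * F (e i) y z)%:E =
    (\sum_j D^-1 * (\sum_i D^-1 * F (e i) (e j) z))%:E)%E.
  rewrite (integral_even (fun y => \sum_i D^-1 * F (e i) y z))//.
  - apply: measurable_sum => i; apply: measurable_funM => //.
    by apply: measurable_triple_powR => //; exact: measurable_cst.
  - by move=> y; apply: sumr_ge0 => i _; rewrite mulr_ge0.
  - by move=> y; apply: eq_bigr => i _; rewrite /F tripleNm.
have intz : (\int[mu]_(z in @sphere R d)
      (\sum_j D^-1 * (\sum_i D^-1 * F (e i) (e j) z))%:E =
    (\sum_k D^-1 * (\sum_j D^-1 * (\sum_i D^-1 * F (e i) (e j) (e k))))%:E)%E.
  rewrite (integral_even
    (fun z => \sum_j D^-1 * (\sum_i D^-1 * F (e i) (e j) z)))//.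
  - apply: measurable_sum => j; apply: measurable_funM => //.
    apply: measurable_sum => i; apply: measurable_funM => //.
    by apply: measurable_triple_powR => //; exact: measurable_cst.
  - move=> z; apply: sumr_ge0 => j _; rewrite mulr_ge0//.
    by apply: sumr_ge0 => i _; rewrite mulr_ge0.
  - move=> z; apply: eq_bigr => j _; congr (_ * _).
    by apply: eq_bigr => i _; rewrite /F tripleNr.
transitivity (\int[mu]_(z in @sphere R d) \int[mu]_(y in @sphere R d)
       \int[mu]_(x in @sphere R d) (F x y z)%:E)%E; first by [].
under eq_integral do under eq_integral do rewrite intx.
under eq_integral do rewrite inty.
rewrite intz; congr EFin.
transitivity (\sum_(k < d) D^-1 ^+ 3).
  apply: eq_bigr => k _; rewrite (bigD1 k)//= [X in _ + X]big1; last first.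
    move=> j jk; rewrite big1 ?mulr0// => i _.
    by rewrite /F triple_orthonormal// (negPf jk) andbF mulr0.
  rewrite addr0 (bigD1 k)//= [X in _ + X]big1; last first.
    by move=> i ik; rewrite /F triple_orthonormal// (negPf ik) mulr0.
  by rewrite /F triple_orthonormal// !eqxx mulr1 !addr0 !exprS expr0 mulr1.
rewrite sumr_const card_ord -[LHS]mulr_natl -/D.
by field; exact: lt0r_neq0.
Qed.

End Converse.

(** * Greedy extraction of an orthonormal basis from the good points [G] *)

Section Greedy.
Context (mu : probability (borelRV R d) R) (G : 'rV[R]_d -> Prop).
Hypothesis G_ae : {ae mu, forall z : borelRV R d, G z}.
Hypothesis G_sphere : forall z, G z -> sphere z.
Hypothesis G_atom : forall z, G z -> mu [set z; - z] = (D^-1)%:E.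
Hypothesis G_dot : forall y z, G y -> G z -> dotv y z = 0 \/ dotv y z ^+ 2 = 1.

(** Indexing by [nat] lets the family be extended by overriding its value at [k]; values beyond the
    chosen ones are junk. *)
Lemma exists_orthonormal_family (k : nat) : (k <= d)%N -> exists e : nat -> 'rV[R]_d,
  (forall i, (i < k)%N -> G (e i)) /\
  (forall i j, (i < k)%N -> (j < k)%N -> dotv (e i) (e j) = (i == j)%:R).
Proof.
elim: k => [_|k IH kd]; first by exists (fun=> 0).
have [e [Ge oe]] := IH (ltnW kd).
pose A i : set (borelRV R d) := [set e i; - e i].
have mA i : measurable (A i) by exact: measurable_pm.
pose U := \big[setU/set0]_(i < k) A i.
have mU : measurable U by apply: bigsetU_measurable => i _.
(* Subadditivity is enough here: [k < d] already makes this bound less than 1. *)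
have Uk : (mu U <= (k%:R * D^-1)%:E)%E.
  apply: (le_trans (le_mu_bigsetU mu (A := A) _)) => //.
  rewrite (eq_bigr (fun=> (D^-1)%:E)); last first.
    by move=> i _; exact/G_atom/Ge.
  by rewrite sumEFin sumr_const card_ord mulr_natl.
have UC0 : mu (~` U) != 0%E.
  rewrite probability_setC// gt_eqF// sube_gt0 (le_lt_trans Uk)//.
  rewrite lte_fin ltr_pdivrMr// mul1r.
  by rewrite ltr_nat.
have [z zU Gz] := ae_exists mu _ (measurableC mU) UC0 G_ae.
(* The alternative in [G_dot] would give [z = e i] or [z = - e i], but [z] was taken outside all
   chosen pairs. *)
have zi i : (i < k)%N -> dotv z (e i) = 0.
  move=> ik; have [//|/eqP] := G_dot z (e i) Gz (Ge i ik).
  rewrite (dotv_sqr_eq1 _ _ (G_sphere z Gz) (G_sphere (e i) (Ge i ik))).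
  move=> /orP zpm; exfalso; apply: zU; apply/bigsetU_ordP.
  by exists (Ordinal ik); case: zpm => /eqP ->; [left|right].
exists (fun i => if i == k then z else e i); split.
  move=> i; rewrite ltnS leq_eqVlt; case: eqP => //= _; exact: Ge.
move=> i j; rewrite !ltnS (leq_eqVlt i) (leq_eqVlt j).
have [->|ik] := eqVneq i k; have [->|jk] := eqVneq j k => //=.
- by move=> _ _; exact: G_sphere.
- by move=> _; exact: zi.
- by rewrite (negPf ik) => ik' _; rewrite dotvC; exact: zi.
- exact: oe.
Qed.

Lemma exists_orthonormal_support : exists e : 'I_d -> 'rV[R]_d,
  orthonormal_basis e /\
  mu (~` [set x | exists j : 'I_d, x = e j \/ x = - e j]) = 0%E /\
  (forall j : 'I_d, mu [set e j; - e j] = (D^-1)%:E).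
Proof.
have [e [Ge oe]] := exists_orthonormal_family d (leqnn d).
have oeb : orthonormal_basis (fun i : 'I_d => e i).
  by move=> i j; rewrite oe.
exists (fun i => e i); split => //; split; last by move=> j; exact/G_atom/Ge.
pose A (i : 'I_d) : set (borelRV R d) := [set e i; - e i].
have mA i : measurable (A i) by exact: measurable_pm.
have -> : [set x | exists j : 'I_d, x = e j \/ x = - e j] =
    \big[setU/set0]_(i < d) A i.
  apply/seteqP; split => x; first by move=> ?; apply/bigsetU_ordP.
  by move=> /bigsetU_ordP.
have mU : measurable (\big[setU/set0]_(i < d) A i).
  by apply: bigsetU_measurable => i _.
(* Exact additivity is now needed: [d] disjoint pairs of mass [1/d] exhaust the total mass. *)
rewrite probability_setC// measure_bigsetU_ord//; last exact: orthonormal_trivIset.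
rewrite (eq_bigr (fun=> (D^-1)%:E)); last by move=> i _; exact/G_atom/Ge.
rewrite sumEFin sumr_const card_ord -[_ *+ d]mulr_natl -/D divff ?subee//.
exact: lt0r_neq0.
Qed.

End Greedy.

End OrthonormalBasis.

Theorem theorem4p4 (R : realType) (d : nat) (p : R)
  (mu : probability (borelRV R d) R) :
  (0 < d)%N -> 0 < p < 1 ->
  mu (~` @sphere R d) = 0%E ->
  ((((d%:R) ^+ 2)^-1)%:E <=
     \int[mu]_(z in @sphere R d) \int[mu]_(y in @sphere R d)
       \int[mu]_(x in @sphere R d)
         (`| dotv x y * dotv x z * dotv y z | `^ p)%:E)%E /\
  ((\int[mu]_(z in @sphere R d) \int[mu]_(y in @sphere R d)
       \int[mu]_(x in @sphere R d)
         (`| dotv x y * dotv x z * dotv y z | `^ p)%:E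
    = (((d%:R) ^+ 2)^-1)%:E)%E <->
   exists e : 'I_d -> 'rV[R]_d,
     orthonormal_basis e /\
     mu (~` [set x | exists j : 'I_d, x = e j \/ x = - e j]) = 0%E /\
     (forall j : 'I_d, mu [set e j; - e j] = ((d%:R)^-1)%:E)).
Proof.
move=> d_gt0 p01 muS; split.
  by rewrite energyE// lee_fin; exact: energy_ge.
split=> [|[e [oe [e_supp e_atom]]]]; last exact: orthonormal_energy oe e_supp e_atom _ p01.
rewrite energyE// => -[energy_eq].
pose Q (z : 'rV[R]_d) := {ae mu, forall y, sphere y -> dotv y z = 0 \/ dotv y z ^+ 2 = 1}.
have atom z : sphere z /\ Q z -> mu [set z; - z] = (d%:R^-1)%:E.
  by move=> [Sz]; exact: energy_eq_atom energy_eq _ Sz.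
apply: (exists_orthonormal_support d_gt0 mu (fun z => sphere z /\ Q z)) => //.
- apply: ae_in => //; first exact: measurable_sphere.
  exact: energy_eq_dot p01 d_gt0 muS energy_eq.
- by move=> z [].
(* [Q z] holds only for almost every point and could fail at [y] itself. Since [{y, -y}] has
   positive mass, the alternative holds at [y] or at [- y], and it is unchanged by the sign. *)
- move=> y z Gy [Sz Qz].
  have atom_neq0 : mu [set y; - y] != 0%E.
    by rewrite atom// eqe invr_eq0 pnatr_eq0 -lt0n.
  have [x xy hx] := ae_exists mu _ (measurable_pm y) atom_neq0 Qz.
  have Sx : sphere x by case: xy => ->; [|apply: sphereN]; case: Gy.
  by have := hx Sx; case: xy => ->; rewrite ?dotvNl ?sqrrN// => -[/eqP|];
    [rewrite oppr_eq0 => /eqP; left|right].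
Qed.
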